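(* Let $V(u)$ be the vector space with basis $[u]_i$ ($i\in\mathbb Z$). The assignment $$(1-q_1)e(z)[u]_i=\delta(q_1^iu/z)[u]_{i+1},\qquad -(1-q_1^{-1})f(z)[u]_i=\delta(q_1^{i-1}u/z)[u]_{i-1},$$ $$\psi^+(z)[u]_i=\frac{(1-q_1^iq_3u/z)(1-q_1^iq_2u/z)}{(1-q_1^iu/z)(1-q_1^{i-1}u/z)}[u]_i,$$ $$\psi^-(z)[u]_i=\frac{(1-q_1^{-i}q_3^{-1}z/u)(1-q_1^{-i}q_2^{-1}z/u)}{(1-q_1^{-i}z/u)(1-q_1^{-i+1}z/u)}[u]_i$$ (where the rational functions are expanded in nonnegative powers of $z^{-1}$ for $\psi^+$ and of $z$ for $\psi^-$) defines a structure of $\mathcal E$-module of level $(1,1)$ on $V(u)$.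
   Context: Let $q_1,q_2,q_3\in\mathbb C^\times$ with $q_i\ne1$, $q_1q_2q_3=1$, and $u\in\mathbb C^\times$. Put $g(z,w)=(z-q_1w)(z-q_2w)(z-q_3w)$. $\mathcal E$ (quantum continuous $\mathfrak{gl}_\infty$) is the unital associative $\mathbb C$-algebra generated by $e_i,f_i$ ($i\in\mathbb Z$), $\psi^+_j,\psi^-_{-j}$ ($j>0$) and $(\psi_0^{\pm})^{\pm1}$. With $e(z)=\sum_{i\in\mathbb Z}e_iz^{-i}$, $f(z)=\sum_{i\in\mathbb Z}f_iz^{-i}$, $\psi^\pm(z)=\sum_{\pm i\ge0}\psi^\pm_iz^{-i}$, $\delta(z)=\sum_{n\in\mathbb Z}z^n$, the defining relations (understood coefficientwise) are $$g(z,w)e(z)e(w)=-g(w,z)e(w)e(z),\quad g(w,z)f(z)f(w)=-g(z,w)f(w)f(z),$$ $$g(z,w)\psi^\pm(z)e(w)=-g(w,z)e(w)\psi^\pm(z),\quad g(w,z)\psi^\pm(z)f(w)=-g(z,w)f(w)\psi^\pm(z),$$ $$[e(z),f(w)]=\frac{\delta(z/w)}{g(1,1)}(\psi^+(z)-\psi^-(z)),\quad [\psi^\pm_i,\psi^\pm_j]=0,\ [\psi^\pm_i,\psi^\mp_j]=0,$$ $$\psi^\pm_0(\psi^\pm_0)^{-1}=(\psi^\pm_0)^{-1}\psi^\pm_0=1,\quad [e_0,[e_1,e_{-1}]]=0,\quad [f_0,[f_1,f_{-1}]]=0.$$ A module has level $(l_+,l_-)$ if $\psi_0^\pm$ act by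 the scalars $l_\pm$. *)

(* Defs.v *)
From HB Require Import structures.
From mathcomp Require Import all_boot all_order all_algebra.
From mathcomp Require Import generic_quotient boolp reals.
From mathcomp Require Import complex.
From mathcomp Require Import finmap.
From mathcomp.multinomials Require Import monalg.

Set Implicit Arguments.
Unset Strict Implicit.
Unset Printing Implicit Defensive.

Import GRing.Theory.
Local Open Scope ring_scope.
Local Open Scope quotient_scope.

(* The free unital associative K-algebra on I is the monoid algebra of the
   free monoid on I. *)
Definition freealg (K : fieldType) (I : choiceType) : Type :=
  {malg K[{fmonom I}]}.

Section FreeAlgebra.
Variables (K : fieldType) (I : choiceType).

HB.instance Definition _ := GRing.Lalgebra.copy (freealg K I) {malg K[{fmonom I}]}.

Lemma freealg_scalerAr (c : K) (x y : freealg K I) :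
  c *: (x * y) = x * (c *: y).
Proof.
apply/malgP=> k; rewrite mcoeffZ.
have le : (msupp (c *: y) `<=` msupp y)%fset by exact: msuppZ_le.
rewrite (mcoeffMl x y) (@mcoeffMlw _ K (msupp x) (msupp y)) //.
rewrite mulr_sumr; apply: eq_bigr => k1 _.
rewrite mulr_sumr; apply: eq_bigr => k2 _.
by rewrite mcoeffZ mulrnAr mulrCA.
Qed.

HB.instance Definition _ :=
  GRing.Lalgebra_isAlgebra.Build K (freealg K I) freealg_scalerAr.

Definition freegen (i : I) : freealg K I := << fmu i >>.

End FreeAlgebra.

(* Quotient of a K-algebra A by the two-sided ideal generated by the elements
   x - y with rel x y.  The quotient may a priori be the zero ring, so it is
   only given the structures of pzRingType and lmodType K, the algebra axioms
   being the lemmas quotalg_scalerAl and quotalg_scalerAr. *)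
Section QuotientAlgebra.
Variables (K : fieldType) (A : algType K) (rel : A -> A -> Prop).

Inductive rel_ideal : A -> Prop :=
| rel_ideal_gen x y : rel x y -> rel_ideal (x - y)
| rel_ideal0 : rel_ideal 0
| rel_idealD x y : rel_ideal x -> rel_ideal y -> rel_ideal (x + y)
| rel_idealMl a x : rel_ideal x -> rel_ideal (a * x)
| rel_idealMr a x : rel_ideal x -> rel_ideal (x * a).

Lemma rel_idealN x : rel_ideal x -> rel_ideal (- x).
Proof. by move=> Ix; rewrite -mulN1r; exact: rel_idealMl. Qed.

Lemma rel_idealZ c x : rel_ideal x -> rel_ideal (c *: x).
Proof. by move=> Ix; rewrite -[x]mul1r scalerAl; exact: rel_idealMl. Qed.

Definition rel_equiv (x y : A) : bool := `[< rel_ideal (x - y) >].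

Lemma rel_equiv_class : equiv_class_of rel_equiv.
Proof.
have sym x y : rel_equiv x y -> rel_equiv y x.
  by move=> /asboolP Ixy; apply/asboolP; rewrite -opprB; exact: rel_idealN.
split=> [x|x y|y x z]; first by apply/asboolP; rewrite subrr; exact: rel_ideal0.
  by apply/idP/idP; exact: sym.
move=> /asboolP Ixy /asboolP Iyz; apply/asboolP.
by rewrite -[x](addrNK y) -addrA; exact: rel_idealD.
Qed.

Canonical rel_equiv_equiv := EquivRelPack rel_equiv_class.
Canonical rel_equiv_encModRel := defaultEncModRel rel_equiv.

Definition quotalg := {eq_quot rel_equiv}.
HB.instance Definition _ : EqQuotient A rel_equiv quotalg :=
  EqQuotient.on quotalg.
HB.instance Definition _ := Choice.on quotalg.

Local Notation pi := \pi_quotalg.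

Lemma quotalg_eqP x y : reflect (pi x = pi y) `[< rel_ideal (x - y) >].
Proof. by apply: (iffP idP) => [h|/eqP]; [apply/eqP|]; rewrite piE. Qed.

Lemma quotalg_repr x : rel_ideal (repr (pi x) - x).
Proof. by apply/asboolP/quotalg_eqP; rewrite reprK. Qed.

Definition quotalg_add := lift_op2 quotalg +%R.
Definition quotalg_opp := lift_op1 quotalg -%R.
Definition quotalg_mul := lift_op2 quotalg *%R.
Definition quotalg_scale (c : K) := lift_op1 quotalg ( *:%R c).

Lemma quotalg_piD x y : pi (x + y) = quotalg_add (pi x) (pi y).
Proof.
unlock quotalg_add; apply/esym/quotalg_eqP/asboolP; rewrite opprD addrACA.
by apply: rel_idealD; exact: quotalg_repr.
Qed.

Lemma quotalg_piN x : pi (- x) = quotalg_opp (pi x).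
Proof.
by unlock quotalg_opp; apply/esym/quotalg_eqP/asboolP; rewrite -opprD;
  apply: rel_idealN; exact: quotalg_repr.
Qed.

Lemma quotalg_piM x y : pi (x * y) = quotalg_mul (pi x) (pi y).
Proof.
unlock quotalg_mul; apply/esym/quotalg_eqP/asboolP; set x' := repr _; set y' := repr _.
rewrite -[x' * y'](addrNK (x * y')) -mulrBl -addrA -mulrBr.
by apply: rel_idealD; [apply: rel_idealMr|apply: rel_idealMl];
  exact: quotalg_repr.
Qed.

Lemma quotalg_piZ c x : pi (c *: x) = quotalg_scale c (pi x).
Proof.
unlock quotalg_scale; apply/esym/quotalg_eqP/asboolP; rewrite -scalerBr.
by apply: rel_idealZ; exact: quotalg_repr.
Qed.

Local Definition piE' :=
  (=^~ quotalg_piD, =^~ quotalg_piN, =^~ quotalg_piM, =^~ quotalg_piZ).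

Lemma quotalg_addA : associative quotalg_add.
Proof.
by elim/quotW=> x; elim/quotW=> y; elim/quotW=> z; rewrite !piE' addrA.
Qed.

Lemma quotalg_addC : commutative quotalg_add.
Proof. by elim/quotW=> x; elim/quotW=> y; rewrite !piE' addrC. Qed.

Lemma quotalg_add0 : left_id (pi 0) quotalg_add.
Proof. by elim/quotW=> x; rewrite !piE' add0r. Qed.

Lemma quotalg_addN : left_inverse (pi 0) quotalg_opp quotalg_add.
Proof. by elim/quotW=> x; rewrite !piE' addNr. Qed.

HB.instance Definition _ := GRing.isZmodule.Build quotalg
  quotalg_addA quotalg_addC quotalg_add0 quotalg_addN.

Lemma quotalg_mulA : associative quotalg_mul.
Proof.
by elim/quotW=> x; elim/quotW=> y; elim/quotW=> z; rewrite !piE' mulrA.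
Qed.

Lemma quotalg_mul1l : left_id (pi 1) quotalg_mul.
Proof. by elim/quotW=> x; rewrite !piE' mul1r. Qed.

Lemma quotalg_mul1r : right_id (pi 1) quotalg_mul.
Proof. by elim/quotW=> x; rewrite !piE' mulr1. Qed.

Lemma quotalg_mulDl : left_distributive quotalg_mul +%R.
Proof.
elim/quotW=> x; elim/quotW=> y; elim/quotW=> z.
by rewrite -[LHS]/(quotalg_mul (quotalg_add _ _) _)
  -[RHS]/(quotalg_add _ _) !piE' mulrDl.
Qed.

Lemma quotalg_mulDr : right_distributive quotalg_mul +%R.
Proof.
elim/quotW=> x; elim/quotW=> y; elim/quotW=> z.
by rewrite -[LHS]/(quotalg_mul _ (quotalg_add _ _))
  -[RHS]/(quotalg_add _ _) !piE' mulrDr.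
Qed.

HB.instance Definition _ := GRing.Zmodule_isPzRing.Build quotalg
  quotalg_mulA quotalg_mul1l quotalg_mul1r quotalg_mulDl quotalg_mulDr.

Lemma quotalg_scaleA a b v :
  quotalg_scale a (quotalg_scale b v) = quotalg_scale (a * b) v.
Proof. by elim/quotW: v => v; rewrite !piE' scalerA. Qed.

Lemma quotalg_scale1 : left_id 1 quotalg_scale.
Proof. by elim/quotW=> v; rewrite !piE' scale1r. Qed.

Lemma quotalg_scaleDr : right_distributive quotalg_scale +%R.
Proof.
move=> c; elim/quotW=> x; elim/quotW=> y.
by rewrite -[LHS]/(quotalg_scale _ (quotalg_add _ _))
  -[RHS]/(quotalg_add _ _) !piE' scalerDr.
Qed.

Lemma quotalg_scaleDl v : {morph quotalg_scale^~ v : a b / a + b}.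
Proof.
elim/quotW: v => v a b /=.
by rewrite -[RHS]/(quotalg_add _ _) !piE' scalerDl.
Qed.

HB.instance Definition _ := GRing.Zmodule_isLmodule.Build K quotalg
  quotalg_scaleA quotalg_scale1 quotalg_scaleDr quotalg_scaleDl.

Lemma quotalg_scalerAl c (x y : quotalg) : c *: (x * y) = (c *: x) * y.
Proof.
elim/quotW: x => x; elim/quotW: y => y.
by rewrite -[LHS]/(quotalg_scale _ (quotalg_mul _ _))
  -[RHS]/(quotalg_mul (quotalg_scale _ _) _) !piE' scalerAl.
Qed.

Lemma quotalg_scalerAr c (x y : quotalg) : c *: (x * y) = x * (c *: y).
Proof.
elim/quotW: x => x; elim/quotW: y => y.
by rewrite -[LHS]/(quotalg_scale _ (quotalg_mul _ _))
  -[RHS]/(quotalg_mul _ (quotalg_scale _ _)) !piE' scalerAr.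
Qed.

Definition quotalg_pi (x : A) : quotalg := pi x.

End QuotientAlgebra.

(* GPsiP j is psi^+_j and GPsiM j is psi^-_{-j} (j >= 0); GPsiP0V and GPsiM0V
   are the inverses of psi^+_0 and psi^-_0. *)
Inductive Egen : Type :=
| GE of int | GF of int | GPsiP of nat | GPsiM of nat | GPsiP0V | GPsiM0V.

Section EgenChoice.

Definition Egen_code (g : Egen) : (int + int) + (nat + nat) + bool :=
  match g with
  | GE i => inl (inl (inl i)) | GF i => inl (inl (inr i))
  | GPsiP j => inl (inr (inl j)) | GPsiM j => inl (inr (inr j))
  | GPsiP0V => inr true | GPsiM0V => inr false
  end.

Definition Egen_decode (c : (int + int) + (nat + nat) + bool) : Egen :=
  match c with
  | inl (inl (inl i)) => GE i | inl (inl (inr i)) => GF i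
  | inl (inr (inl j)) => GPsiP j | inl (inr (inr j)) => GPsiM j
  | inr true => GPsiP0V | inr false => GPsiM0V
  end.

Lemma Egen_codeK : cancel Egen_code Egen_decode. Proof. by case. Qed.

HB.instance Definition _ := Choice.copy Egen (can_type Egen_codeK).

End EgenChoice.

(* A formal series h(z) = \sum_m h_m z^-m is the family m |-> h_m, and a formal
   series in z and w is the family of its coefficients of z^-m w^-n. *)
Section Series.
Variables (K : fieldType) (A : lalgType K).

(* multiplication by a z + b w *)
Definition mul_lin (a b : K) (F : int -> int -> A) (m n : int) : A :=
  a *: F (m + 1) n + b *: F m (n + 1).

(* (z - q1 w)(z - q2 w)(z - q3 w) F(z, w) *)
Definition mul_gzw (q1 q2 q3 : K) (F : int -> int -> A) : int -> int -> A :=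
  mul_lin 1 (- q1) (mul_lin 1 (- q2) (mul_lin 1 (- q3) F)).

(* (w - q1 z)(w - q2 z)(w - q3 z) F(z, w) *)
Definition mul_gwz (q1 q2 q3 : K) (F : int -> int -> A) : int -> int -> A :=
  mul_lin (- q1) 1 (mul_lin (- q2) 1 (mul_lin (- q3) 1 F)).

(* x(z) y(w) and y(w) x(z) *)
Definition ser_zw (x y : int -> A) (m n : int) : A := x m * y n.
Definition ser_wz (y x : int -> A) (m n : int) : A := y n * x m.

(* delta(z/w) h(z) = \sum_(k, j) h_j z^(k-j) w^-k *)
Definition mul_delta (h : int -> A) (m n : int) : A := h (m + n).

End Series.

Definition commutator (A : pzRingType) (x y : A) : A := x * y - y * x.

Section QuantumContinuousGlInfinity.
Variables (K : fieldType) (q1 q2 q3 : K).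

Definition gpoly (z w : K) : K := (z - q1 * w) * (z - q2 * w) * (z - q3 * w).

Local Notation F := (freealg K Egen).
Local Notation gen g := (freegen K g).

Definition e_ser (i : int) : F := gen (GE i).
Definition f_ser (i : int) : F := gen (GF i).
Definition psip_ser (i : int) : F := if 0 <= i then gen (GPsiP `|i|%N) else 0.
Definition psim_ser (i : int) : F := if i <= 0 then gen (GPsiM `|i|%N) else 0.

Local Notation gzw := (mul_gzw q1 q2 q3).
Local Notation gwz := (mul_gwz q1 q2 q3).

Inductive Erel : F -> F -> Prop :=
| Erel_ee m n : Erel (gzw (ser_zw e_ser e_ser) m n)
                     (- gwz (ser_wz e_ser e_ser) m n)
| Erel_ff m n : Erel (gwz (ser_zw f_ser f_ser) m n)
                     (- gzw (ser_wz f_ser f_ser) m n)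
| Erel_psipe m n : Erel (gzw (ser_zw psip_ser e_ser) m n)
                        (- gwz (ser_wz e_ser psip_ser) m n)
| Erel_psime m n : Erel (gzw (ser_zw psim_ser e_ser) m n)
                        (- gwz (ser_wz e_ser psim_ser) m n)
| Erel_psipf m n : Erel (gwz (ser_zw psip_ser f_ser) m n)
                        (- gzw (ser_wz f_ser psip_ser) m n)
| Erel_psimf m n : Erel (gwz (ser_zw psim_ser f_ser) m n)
                        (- gzw (ser_wz f_ser psim_ser) m n)
| Erel_ef m n : Erel (commutator (e_ser m) (f_ser n))
    ((gpoly 1 1)^-1 *: mul_delta (fun i => psip_ser i - psim_ser i) m n)
| Erel_pp i j : Erel (commutator (gen (GPsiP i)) (gen (GPsiP j))) 0
| Erel_mm i j : Erel (commutator (gen (GPsiM i)) (gen (GPsiM j))) 0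
| Erel_pm i j : Erel (commutator (gen (GPsiP i)) (gen (GPsiM j))) 0
| Erel_pV : Erel (gen (GPsiP 0) * gen GPsiP0V) 1
| Erel_Vp : Erel (gen GPsiP0V * gen (GPsiP 0)) 1
| Erel_mV : Erel (gen (GPsiM 0) * gen GPsiM0V) 1
| Erel_Vm : Erel (gen GPsiM0V * gen (GPsiM 0)) 1
| Erel_eee : Erel (commutator (e_ser 0) (commutator (e_ser 1) (e_ser (-1)))) 0
| Erel_fff : Erel (commutator (f_ser 0) (commutator (f_ser 1) (f_ser (-1)))) 0.

Definition Ealg : Type := quotalg Erel.
HB.instance Definition _ := GRing.PzRing.on Ealg.
HB.instance Definition _ := GRing.Lmodule.on Ealg.

Definition Eof (g : Egen) : Ealg := quotalg_pi Erel (gen g).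

End QuantumContinuousGlInfinity.

Section Modules.
Variables (K : fieldType) (q1 q2 q3 : K) (V : lmodType K).
Local Notation E := (Ealg q1 q2 q3).
Local Notation gen := (Eof q1 q2 q3).

(* act is a left E-module structure on the K-vector space V. *)
Definition is_Emodule (act : E -> V -> V) : Prop :=
  [/\ forall a : E, linear (act a),
      forall v : V, linear (act ^~ v),
      forall v : V, act 1 v = v
    & forall (a b : E) (v : V), act (a * b) v = act a (act b v)].

Definition has_level (act : E -> V -> V) (lp lm : K) : Prop :=
  forall v : V, act (gen (GPsiP 0)) v = lp *: v /\
                act (gen (GPsiM 0)) v = lm *: v.

End Modules.

(* Coefficients of the expansion of N / D in nonnegative powers of the
   variable, for D with nonzero constant term; see ratserP. *)
Section RationalExpansion.
Variables (K : fieldType) (N D : {poly K}).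

Fixpoint ratser_seq (n : nat) : seq K :=
  if n is n'.+1 then
    let s := ratser_seq n' in
    rcons s ((N`_n' - \sum_(k < n') D`_(n' - k) * s`_k) / D`_0)
  else [::].

Definition ratser (n : nat) : K := (ratser_seq n.+1)`_n.

Lemma size_ratser_seq n : size (ratser_seq n) = n.
Proof. by elim: n => //= n IHn; rewrite size_rcons IHn. Qed.

Lemma nth_ratser_seq n k : (k < n)%N -> (ratser_seq n)`_k = ratser k.
Proof.
elim: n => // n IHn; rewrite ltnS leq_eqVlt => /predU1P[-> //|ltkn].
by rewrite -IHn //= nth_rcons size_ratser_seq ltkn.
Qed.

Lemma ratserP : D`_0 != 0 ->
  forall n, \sum_(k < n.+1) D`_(n - k) * ratser k = N`_n.
Proof.
move=> D0 n; rewrite big_ord_recr /= subnn {2}/ratser /=.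
rewrite nth_rcons size_ratser_seq ltnn eqxx mulrCA divff // mulr1.
under [X in _ - X]eq_bigr => k _ do rewrite nth_ratser_seq //.
by rewrite addrC subrK.
Qed.

End RationalExpansion.

(* V(u): the vector space with basis [u]_i, i in Z.  It depends on u only
   through the name of its basis vectors. *)
Definition Vu (K : fieldType) (u : K) : Type := {malg K[int]}.
HB.instance Definition _ (K : fieldType) (u : K) := GRing.Lmodule.on (Vu u).

Definition ubase (K : fieldType) (u : K) (i : int) : Vu u := << i >>.

(* delta(a/z) = \sum_n a^n z^-n *)
Definition delta_coef (K : fieldType) (a : K) (n : int) : K := a ^ n.

Section VectorRepresentation.
Variables (K : fieldType) (q1 q2 q3 u : K).

(* the eigenvalue of psi^+(z) on [u]_i, as a series in z^-1 *)
Definition psip_eig (i : int) : nat -> K :=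
  ratser ((1 - (q1 ^ i * q3 * u) *: 'X) * (1 - (q1 ^ i * q2 * u) *: 'X))
         ((1 - (q1 ^ i * u) *: 'X) * (1 - (q1 ^ (i - 1) * u) *: 'X)).

(* the eigenvalue of psi^-(z) on [u]_i, as a series in z *)
Definition psim_eig (i : int) : nat -> K :=
  ratser ((1 - (q1 ^ (- i) * q3^-1 / u) *: 'X) *
          (1 - (q1 ^ (- i) * q2^-1 / u) *: 'X))
         ((1 - (q1 ^ (- i) / u) *: 'X) * (1 - (q1 ^ (- i + 1) / u) *: 'X)).

Definition Vu_assignment (act : Ealg q1 q2 q3 -> Vu u -> Vu u) : Prop :=
  let ket := ubase u in let gen := Eof q1 q2 q3 in
  [/\ forall n i, (1 - q1) *: act (gen (GE n)) (ket i)
                  = delta_coef (q1 ^ i * u) n *: ket (i + 1),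
      forall n i, - (1 - q1^-1) *: act (gen (GF n)) (ket i)
                  = delta_coef (q1 ^ (i - 1) * u) n *: ket (i - 1),
      forall j i, act (gen (GPsiP j)) (ket i) = psip_eig i j *: ket i
    & forall j i, act (gen (GPsiM j)) (ket i) = psim_eig i j *: ket i].

End VectorRepresentation.

(* Main.v *)
Require Import Defs.
From HB Require Import structures.
From mathcomp Require Import all_boot all_order all_algebra.
From mathcomp Require Import generic_quotient boolp reals complex finmap ring zify.
From mathcomp.multinomials Require Import monalg.

(** The generators act on the basis vectors [u]_i by weighted shifts, so they
    define an action of the free algebra on V(u), and an action of E amounts to
    checking the defining relations on each [u]_i.  Put x_i = q1^i u.

    - e(z) and f(z) move [u]_i along the points x_i: a product e(z) e(w) sends
      [u]_i to a delta function supported at w = x_i, z = x_(i+1) = q1 w, where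
      g(z, w) vanishes; both sides of the ee relation are therefore zero, and
      likewise for ff ([rho_ee], [rho_ff]).  Each cubic relation [e_0, [e_1,
      e_-1]] = 0 holds because [e_1, e_-1] multiplies every basis vector by the
      same scalar before shifting it by 2 ([rho_eee], [rho_fff]).

    - With t = x_i / z, and since q1 q2 q3 = 1, the eigenvalue of psi on [u]_i
      is the rational function
        (1 - q2 t)(1 - q3 t) / ((1 - t)(1 - t / q1))
          = 1 + A / (1 - t) - A / (1 - t / q1),
      where A = (1 - q2)(1 - q3) / (1 - q1^-1).  The series psi^+ and psi^- are
      its expansions at z = oo and z = 0, with coefficients given in closed form
      by [ratser_quadratics].  Their difference is the two-sided exponential
      series A (x_i^m - x_(i-1)^m) ([psi_jumpE]), which is what the commutator
      of e and f produces ([rho_ef]).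

    - The relations of psi with e and f both reduce to the single identity
      g(z, x) Psi_(q1 x)(z) = - g(x, z) Psi_x(z) ([psip_intertwine] and
      [psim_intertwine]).  For psi^+ it is checked coefficient by coefficient:
      above the constant term it is an identity between exponentials, and only
      finitely many boundary coefficients remain.  It then passes to psi^-
      because it holds for the difference psi^+ - psi^-.

    Finally the assignment prescribes the action of every generator except the
    inverses of psi_0^+ and psi_0^-; as psi_0^+ and psi_0^- act by 1, so must
    their inverses, whence uniqueness ([Vu_action_unique]). *)

Set Implicit Arguments.
Unset Strict Implicit.
Unset Printing Implicit Defensive.

Import Order.TTheory GRing.Theory Num.Theory.
Local Open Scope ring_scope.
Local Open Scope quotient_scope.

(** * Linear maps out of a space with a given basis *)

Section LinearExtension.
Variables (K : fieldType) (I : choiceType) (V : lmodType K).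
Implicit Types (h : I -> V) (x : {malg K[I]}).

Definition malg_lift h x : V := \sum_(k <- msupp x) x@_k *: h k.

Lemma malg_liftEw h (d : {fset I}) x :
  (msupp x `<=` d)%fset -> malg_lift h x = \sum_(k <- d) x@_k *: h k.
Proof.
move=> le; rewrite /malg_lift (big_fset_incl _ le) // => k _ /mcoeff_outdom ->.
by rewrite scale0r.
Qed.

Lemma malg_lift_is_linear h : linear (malg_lift h).
Proof.
move=> c x y; pose d := (msupp x `|` msupp y)%fset.
have xd : (msupp x `<=` d)%fset by exact: fsubsetUl.
have yd : (msupp y `<=` d)%fset by exact: fsubsetUr.
have xyd : (msupp (c *: x + y) `<=` d)%fset.
  by apply: fsubset_trans (msuppD_le _ _) _; rewrite fsetSU // msuppZ_le.
rewrite (malg_liftEw h xd) (malg_liftEw h yd) (malg_liftEw h xyd).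
rewrite scaler_sumr -big_split /=; apply: eq_bigr => k _.
by rewrite mcoeffD mcoeffZ scalerDl scalerA.
Qed.

HB.instance Definition _ h :=
  GRing.isLinear.Build K {malg K[I]} V _ (malg_lift h) (malg_lift_is_linear h).

Lemma malg_liftU h k : malg_lift h << k >> = h k.
Proof. by rewrite /malg_lift msuppU oner_eq0 big_seq_fset1 mcoeffUU scale1r. Qed.

Lemma malg_liftE (F : {linear {malg K[I]} -> V}) x :
  F x = malg_lift (fun k => F << k >>) x.
Proof.
rewrite [in LHS](monalgE x) raddf_sum; apply: eq_bigr => k _.
rewrite -linearZ; congr (F _).
by apply/malgP => k'; rewrite mcoeffZ !mcoeffU mulrnAr mulr1.
Qed.

Lemma eq_malg_linear (f g : {malg K[I]} -> V) :
  linear f -> linear g -> (forall k, f << k >> = g << k >>) -> f =1 g.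
Proof.
move=> lf lg fg x.
pose F := HB.pack_for {linear {malg K[I]} -> V} f
            (GRing.isLinear.Build K {malg K[I]} V _ f lf).
pose G := HB.pack_for {linear {malg K[I]} -> V} g
            (GRing.isLinear.Build K {malg K[I]} V _ g lg).
rewrite [LHS](malg_liftE F) [RHS](malg_liftE G).
by apply: eq_bigr => k _; rewrite [F _]fg.
Qed.

End LinearExtension.

(** * Modules over a free algebra *)

Section FreeAlgebraAction.
Variables (K : fieldType) (I : choiceType) (V : lmodType K).
Variable (T : I -> {linear V -> V}).

Definition freealg_act (x : freealg K I) (v : V) : V :=
  malg_lift (fun w : {fmonom I} => foldr (fun i => T i) v w) x.

Lemma freealg_act_linearl v : linear (freealg_act^~ v).
Proof. exact: malg_lift_is_linear. Qed.

Lemma word_act_linear (w : seq I) : linear (fun v => foldr (fun i => T i) v w).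
Proof. by elim: w => [|i w IHw] c v v' //=; rewrite IHw linearP. Qed.

Lemma freealg_act_linearr x : linear (freealg_act x).
Proof.
move=> c v v'; rewrite /freealg_act /malg_lift scaler_sumr -big_split /=.
apply: eq_bigr => w _.
by rewrite word_act_linear scalerDr !scalerA mulrC.
Qed.

HB.instance Definition _ x :=
  GRing.isLinear.Build K V V _ (freealg_act x) (freealg_act_linearr x).

Lemma freealg_act0 v : freealg_act 0 v = 0.
Proof. exact: (linear0 (malg_lift _)). Qed.

Lemma freealg_actD x y v : freealg_act (x + y) v = freealg_act x v + freealg_act y v.
Proof. exact: (linearD (malg_lift _)). Qed.

Lemma freealg_actN x v : freealg_act (- x) v = - freealg_act x v.
Proof. exact: (linearN (malg_lift _)). Qed.

Lemma freealg_actB x y v : freealg_act (x - y) v = freealg_act x v - freealg_act y v.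
Proof. exact: (linearB (malg_lift _)). Qed.

Lemma freealg_actZ c x v : freealg_act (c *: x) v = c *: freealg_act x v.
Proof. exact: (linearZ_LR (malg_lift _)). Qed.

Lemma freealg_act_gen i v : freealg_act (freegen K i) v = T i v.
Proof. by rewrite /freealg_act malg_liftU fmU. Qed.

Lemma freealg_act1 v : freealg_act 1 v = v.
Proof. by rewrite /freealg_act malg_liftU fm1. Qed.

Lemma freealg_actM x y v : freealg_act (x * y) v = freealg_act x (freealg_act y v).
Proof.
apply: (eq_malg_linear (f := fun x => freealg_act (x * y) v)
          (g := fun x => freealg_act x (freealg_act y v))) => [c a b|c a b|w].
- by rewrite mulrDl -scalerAl freealg_act_linearl.
- exact: freealg_act_linearl.
apply: (eq_malg_linear (f := fun y => freealg_act (<< w >> * y : freealg K I) v)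
          (g := fun y => freealg_act << w >> (freealg_act y v)))
  => [c a b|c a b|w'].
- rewrite -freealg_act_linearl; congr freealg_act.
  by rewrite [LHS]mulrDr; congr (_ + _); rewrite [RHS]freealg_scalerAr.
- by rewrite freealg_act_linearl linearP.
have -> : << w >> * << w' >> = << mmul w w' >> :> {malg K[{fmonom I}]}.
  by rewrite malgM_def fgmulUU mulr1.
by rewrite /freealg_act !malg_liftU fmM foldr_cat.
Qed.

(** On a basis every operator below is a weighted shift; this and the next
    lemma compose such operators by multiplying their weights. *)
Lemma freealg_actM_scale x y v w w' c d :
  freealg_act y v = c *: w -> freealg_act x w = d *: w' ->
  freealg_act (x * y) v = (c * d) *: w'.
Proof.
move=> yv xw; rewrite freealg_actM yv -scalerA -xw.
exact: (linearZ_LR (freealg_act x)).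
Qed.

Lemma freealg_act_commutator_scale x y v w1 w2 w a b c d :
  freealg_act y v = a *: w1 -> freealg_act x w1 = b *: w ->
  freealg_act x v = c *: w2 -> freealg_act y w2 = d *: w ->
  freealg_act (commutator x y) v = (a * b - c * d) *: w.
Proof.
move=> yv xw1 xv yw2; rewrite freealg_actB scalerBl.
by rewrite -(freealg_actM_scale yv xw1) -(freealg_actM_scale xv yw2).
Qed.

End FreeAlgebraAction.

(** * Modules over a presented algebra *)

Section PresentedAlgebraModule.
Variables (K : fieldType) (I : choiceType) (V : lmodType K).
Variable rel : freealg K I -> freealg K I -> Prop.
Local Notation Q := (quotalg rel).
Local Notation pi := (quotalg_pi rel).

(** The conditions of [is_Emodule], for an arbitrary presentation. *)
Record module_axioms (act : Q -> V -> V) : Prop := {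
  mod_linearr : forall a, linear (act a);
  mod_linearl : forall v, linear (act^~ v);
  mod_act1 : forall v, act 1 v = v;
  mod_actM : forall a b v, act (a * b) v = act a (act b v) }.

Section Existence.
Variable T : I -> {linear V -> V}.
Hypothesis Trel :
  forall x y, rel x y -> forall v, freealg_act T x v = freealg_act T y v.

Definition presented_act (a : Q) : V -> V := freealg_act T (repr a).

(** The annihilator of V is a two-sided ideal, so it contains the ideal generated
    by the relations as soon as it contains the relations. *)
Lemma freealg_act_ideal x : rel_ideal rel x -> forall v, freealg_act T x v = 0.
Proof.
elim=> {x} [x y xy|//|x y _ IHx _ IHy|a x _ IHx|a x _ IHx] v.
- by rewrite freealg_actB (Trel xy) subrr.
- by rewrite freealg_act0.
- by rewrite freealg_actD IHx IHy addr0.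
- by rewrite freealg_actM IHx linear0.
- by rewrite freealg_actM IHx.
Qed.

Lemma presented_act_pi x v : presented_act (pi x) v = freealg_act T x v.
Proof.
apply/eqP; rewrite -subr_eq0 -freealg_actB; apply/eqP.
exact/freealg_act_ideal/quotalg_repr.
Qed.

Lemma presented_act_module : module_axioms presented_act.
Proof.
split=> [a|v c a b|v|a b v].
- exact: freealg_act_linearr.
- elim/quotW: a => x; elim/quotW: b => y.
  have -> : c *: \pi_(Q) x + \pi_(Q) y = pi (c *: x + y).
    by rewrite /quotalg_pi quotalg_piD quotalg_piZ.
  by rewrite !presented_act_pi freealg_act_linearl.
- by rewrite -[1]/(pi 1) presented_act_pi freealg_act1.
- elim/quotW: a => x; elim/quotW: b => y.
  have -> : \pi_(Q) x * \pi_(Q) y = pi (x * y) by rewrite /quotalg_pi quotalg_piM.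
  by rewrite !presented_act_pi freealg_actM.
Qed.

End Existence.

(** A module structure is determined by the generators: words in them span the
    algebra, and each word acts by the composite of its letters. *)
Lemma eq_module_action (act act' : Q -> V -> V) :
  module_axioms act -> module_axioms act' ->
  (forall i v, act (pi (freegen K i)) v = act' (pi (freegen K i)) v) ->
  forall a v, act a v = act' a v.
Proof.
move=> mod mod' gen a v; elim/quotW: a => x.
have piP c y z : pi (c *: y + z) = c *: pi y + pi z.
  by rewrite /quotalg_pi quotalg_piD quotalg_piZ.
apply: (eq_malg_linear (f := fun x => act (pi x) v)
          (g := fun x => act' (pi x) v)) => [c y z|c y z|w] /=.
- by rewrite piP (mod_linearl mod).
- by rewrite piP (mod_linearl mod').
rewrite -[w]fmK; elim: (w : seq I) v => [|i s IHs] v.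
  have -> : pi << FMonom [::] >> = 1 by rewrite -fmoneE.
  by rewrite (mod_act1 mod) (mod_act1 mod').
have -> : pi << FMonom (i :: s) >> = pi (freegen K i) * pi << FMonom s >>.
  rewrite /quotalg_pi -[RHS]quotalg_piM; congr (\pi _).
  rewrite [RHS]malgM_def fgmulUU mulr1; congr mkmalgU.
  by apply/eqP; rewrite fmP fmM fmU.
by rewrite (mod_actM mod) (mod_actM mod') IHs gen.
Qed.

End PresentedAlgebraModule.

(** * Expansion of rational functions *)

Section RationalExpansion.
Variable K : fieldType.

(** Multiplication by D is triangular with diagonal D(0), which is invertible. *)
Lemma ratser_uniq (N D : {poly K}) (s : nat -> K) : D`_0 != 0 ->
  (forall n, \sum_(k < n.+1) D`_(n - k) * s k = N`_n) -> ratser N D =1 s.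
Proof.
move=> D0 sP; elim/ltn_ind=> n IHn.
have := sP n; rewrite -(ratserP N D0 n) !big_ord_recr /= subnn.
under eq_bigr => k _ do rewrite -IHn //.
by move/addrI/(mulfI D0).
Qed.

(** Partial fractions: N / D = 1 + A / (1 - x t) - A / (1 - y t), with constant 1
    because N and D have the same coefficient of t^2. *)
Lemma ratser_quadratics (a b x y A : K) : a * b = x * y ->
  A * (x - y) = x + y - a - b ->
  forall n, ratser ((1 - a *: 'X) * (1 - b *: 'X)) ((1 - x *: 'X) * (1 - y *: 'X)) n
            = (n == 0)%:R + A * (x ^+ n - y ^+ n).
Proof.
move=> ab Axy.
have coef2 (c d : K) n : ((1 - c *: 'X) * (1 - d *: 'X))`_n
    = (n == 0)%:R - (c + d) * (n == 1)%:R + c * d * (n == 2)%:R :> K.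
  have -> : (1 - c *: 'X) * (1 - d *: 'X)
            = 1 - (c + d) *: 'X + (c * d) *: 'X^2 :> {poly K}.
    by rewrite -!mul_polyC rmorphD rmorphM /=; ring.
  by rewrite coefD coefB coef1 !coefZ coefX coefXn.
apply: ratser_uniq => [|n]; first by rewrite coef2 !mulr0 subr0 addr0 oner_eq0.
under eq_bigr => k _ do rewrite coef2.
rewrite coef2; case: n => [|[|n]].
- by rewrite big_ord_recr big_ord0 /=; ring.
- rewrite !big_ord_recr big_ord0 /= !expr1 !expr0.
  by transitivity (x + y - a - b - (x + y)); [rewrite -Axy|]; ring.
(* D has degree 2: all but the last three summands vanish. *)
rewrite !big_ord_recr /= big1 => [|k _]; last first.
  have ltkn := ltn_ord k.
  have -> : (n.+2 - k)%N = (n - k).+2 by lia.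
  have -> : ((n - k).+2 == 2)%N = false by lia.
  by rewrite /= !mulr0 subr0 addr0 mul0r.
rewrite subnn subSnn (_ : n.+2 - n = 2)%N; last by lia.
rewrite /= ab; case: n => [|n] /=; rewrite ?exprS ?expr0; ring.
Qed.

End RationalExpansion.

(** * Multiplication by g(z, w) on separated series *)

Section ShiftOperators.
Variables (K : fieldType) (q1 q2 q3 : K).
Local Notation gzw := (@mul_gzw K K^o q1 q2 q3).
Local Notation gwz := (@mul_gwz K K^o q1 q2 q3).

(** [gz_shift b s m] is the coefficient of z^-m in g(z, b) s(z), and [gw_shift]
    that in g(b, z) s(z). *)
Definition gz_shift (b : K) (s : int -> K) (m : int) : K :=
  s (m + 1 + 1 + 1) - (q1 + q2 + q3) * b * s (m + 1 + 1)
  + (q1 * q2 + q1 * q3 + q2 * q3) * b ^+ 2 * s (m + 1) - q1 * q2 * q3 * b ^+ 3 * s m.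

Definition gw_shift (b : K) (s : int -> K) (m : int) : K :=
  - (q1 * q2 * q3) * s (m + 1 + 1 + 1)
  + (q1 * q2 + q1 * q3 + q2 * q3) * b * s (m + 1 + 1)
  - (q1 + q2 + q3) * b ^+ 2 * s (m + 1) + b ^+ 3 * s m.

(** The series \sum_n b^n w^-n is delta(b / w), whose product with g(z, w) only
    sees w = b: the two-variable relations become relations in z alone. *)
Lemma mul_gzw_sep (b c : K) (s : int -> K) (m n : int) : b != 0 ->
  gzw (fun m n => c * s m * b ^ n) m n = c * gz_shift b s m * b ^ n.
Proof.
move=> b0; rewrite /mul_gzw /mul_lin /gz_shift /GRing.scale /=.
by rewrite !expfzDr // expr1z; ring.
Qed.

Lemma mul_gwz_sep (b c : K) (s : int -> K) (m n : int) : b != 0 ->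
  gwz (fun m n => c * s m * b ^ n) m n = c * gw_shift b s m * b ^ n.
Proof.
move=> b0; rewrite /mul_gwz /mul_lin /gw_shift /GRing.scale /=.
by rewrite !expfzDr // expr1z; ring.
Qed.

Lemma gz_shift_exp (a b : K) m : a != 0 ->
  gz_shift b (fun m => a ^ m) m = gpoly q1 q2 q3 a b * a ^ m.
Proof. by move=> a0; rewrite /gz_shift /gpoly !expfzDr // expr1z; ring. Qed.

Lemma gw_shift_exp (a b : K) m : a != 0 ->
  gw_shift b (fun m => a ^ m) m = gpoly q1 q2 q3 b a * a ^ m.
Proof. by move=> a0; rewrite /gw_shift /gpoly !expfzDr // expr1z; ring. Qed.

End ShiftOperators.

(** * The eigenvalues of the Cartan currents *)

Section PsiSeries.
Variables (K : fieldType) (q1 q2 q3 : K).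
Hypotheses (q1_neq0 : q1 != 0) (q1_neq1 : q1 != 1) (q123 : q1 * q2 * q3 = 1).

Implicit Types (x : K) (m : int).

(** The coefficient A in the partial fraction expansion
    1 + A / (1 - x / z) - A / (1 - x / (q1 z)) of the eigenvalue of psi(z) at the
    point x. *)
Definition psi_res : K := (1 - q2) * (1 - q3) / (1 - q1^-1).
(** The coefficients of A delta(x / z) - A delta(x / (q1 z)), by which the two
    expansions of the eigenvalue differ. *)
Definition psi_jump (x : K) (m : int) : K := psi_res * (x ^ m - (x / q1) ^ m).
Definition psip_coef (x : K) (m : int) : K :=
  (m == 0)%:R + (if 0 <= m then psi_jump x m else 0).
Definition psim_coef (x : K) (m : int) : K :=
  (m == 0)%:R - (if m <= 0 then psi_jump x m else 0).

Lemma psi_jumpE x m : psip_coef x m - psim_coef x m = psi_jump x m.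
Proof.
rewrite /psip_coef /psim_coef; case: (ltgtP m 0) => [||->]; rewrite /psi_jump.
- by rewrite /= sub0r add0r opprK add0r.
- by rewrite /= subr0 subr0 add0r.
- by rewrite !expr0z subrr mulr0 addr0 subr0 subrr.
Qed.

(** On both sides only the delta function at z = x survives, with coefficient
    - A g(x, x): g(z, x) kills the one at z = q1 x and g(x, z) the one at
    z = x / q1. *)
Lemma psi_jump_intertwine x m : x != 0 ->
  gz_shift q1 q2 q3 x (psi_jump (q1 * x)) m
  = - gw_shift q1 q2 q3 x (psi_jump x) m.
Proof.
move=> x0.
have lin (S : (int -> K) -> int -> K) :
    (forall s t c k, S (fun k => c * (s k - t k)) k = c * (S s k - S t k)) ->
    forall a, S (psi_jump a) m
              = psi_res * (S (fun k => a ^ k) m - S (fun k => (a / q1) ^ k) m).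
  by move=> S_lin a; rewrite -S_lin.
rewrite !lin; try by move=> *; rewrite /gz_shift /gw_shift; ring.
rewrite !gz_shift_exp ?gw_shift_exp ?mulf_neq0 ?invr_neq0 //.
have -> : q1 * x / q1 = x by rewrite mulrAC divff ?mul1r.
have -> : gpoly q1 q2 q3 (q1 * x) x = 0 by rewrite /gpoly subrr !mul0r.
have -> : gpoly q1 q2 q3 x (x / q1) = 0.
  by rewrite /gpoly mulrCA divff // mulr1 subrr !mul0r.
by ring.
Qed.

(** For m >= 0 the relation differs from the one between exponentials only by the
    constant term of the series, which meets the coefficient - q1 q2 q3 x^3 on
    one side and - x^3 on the other.  Below m = -3 all coefficients vanish, and
    m = -1, -2, -3 are rational identities. *)
Lemma psip_intertwine x m : x != 0 ->
  gz_shift q1 q2 q3 x (psip_coef (q1 * x)) m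
  = - gw_shift q1 q2 q3 x (psip_coef x) m.
Proof.
move=> x0.
have J n a : psip_coef a n.+1 = psi_res * (a ^+ n.+1 - (a / q1) ^+ n.+1).
  by rewrite /psip_coef /= add0r.
have O a : psip_coef a (Posz 0) = 1.
  by rewrite /psip_coef /psi_jump /= !expr0z subrr mulr0 addr0.
have N n a : psip_coef a (Negz n) = 0 by rewrite /psip_coef /= addr0.
have q2_neq0 : q2 != 0.
  by apply: contraNneq (oner_neq0 K) => q20; rewrite -q123 q20 mulr0 mul0r.
have q3E : q3 = (q1 * q2)^-1.
  by apply: (mulfI (mulf_neq0 q1_neq0 q2_neq0)); rewrite divff ?mulf_neq0.
have q1B : q1 - 1 != 0 by rewrite subr_eq0.
have NegzS k : Negz k.+1 + 1 = Negz k by lia.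
case: m => [n|[|[|[|n]]]].
- have := psi_jump_intertwine n x0.
  rewrite /gz_shift /gw_shift -!PoszD !addn1 !J q123.
  rewrite /psip_coef /psi_jump /= -!exprnP => /eqP; rewrite -subr_eq0 => /eqP e0.
  by apply/eqP; rewrite -subr_eq0 -e0; apply/eqP; ring.
- rewrite /gz_shift /gw_shift -[Negz 0 + 1]/(Posz 0) -!PoszD !J !O !N.
  by rewrite q3E /psi_res q3E; field; rewrite q1_neq0 q2_neq0 q1B.
- rewrite /gz_shift /gw_shift NegzS -[Negz 0 + 1]/(Posz 0) -!PoszD !J !O !N.
  by rewrite q3E /psi_res q3E; field; rewrite q1_neq0 q2_neq0 q1B.
- rewrite /gz_shift /gw_shift !NegzS -[Negz 0 + 1]/(Posz 0) !O !N q123.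
  by ring.
rewrite /gz_shift /gw_shift !NegzS !N.
by rewrite !mulr0 !(subr0, addr0, oppr0).
Qed.

Lemma psim_intertwine x m : x != 0 ->
  gz_shift q1 q2 q3 x (psim_coef (q1 * x)) m
  = - gw_shift q1 q2 q3 x (psim_coef x) m.
Proof.
move=> x0; have psimE a m' : psim_coef a m' = psip_coef a m' - psi_jump a m'.
  by rewrite -psi_jumpE opprB addrC subrK.
have -> : gz_shift q1 q2 q3 x (psim_coef (q1 * x)) m
    = gz_shift q1 q2 q3 x (psip_coef (q1 * x)) m
      - gz_shift q1 q2 q3 x (psi_jump (q1 * x)) m.
  by rewrite /gz_shift !psimE; ring.
rewrite psip_intertwine // psi_jump_intertwine // /gw_shift !psimE; ring.
Qed.

End PsiSeries.

(** * The vector representation *)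

Section VectorRepresentation.
Variables (K : fieldType) (q1 q2 q3 u : K).
Hypotheses (q1_neq0 : q1 != 0) (q2_neq0 : q2 != 0).
Hypotheses (q1_neq1 : q1 != 1) (q2_neq1 : q2 != 1) (q3_neq1 : q3 != 1).
Hypotheses (q123 : q1 * q2 * q3 = 1) (u_neq0 : u != 0).

Local Notation V := (Vu u).
Local Notation ket := (ubase u).
Local Notation psip := (psip_coef q1 q2 q3).
Local Notation psim := (psim_coef q1 q2 q3).
Local Notation jump := (psi_jump q1 q2 q3).

(** The point of evaluation x_i: e(z) takes [u]_i to a multiple of
    delta(x_i / z) [u]_(i+1). *)
Definition ev_pt (i : int) : K := q1 ^ i * u.
Local Notation x := ev_pt.

Definition Vu_shift (g : Egen) : int :=
  match g with GE _ => 1 | GF _ => -1 | _ => 0 end.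

(** Each generator acts by a weighted shift: [u]_i is sent to
    [Vu_coef g i] [u]_(i + [Vu_shift g]). *)
Definition Vu_coef (g : Egen) (i : int) : K :=
  match g with
  | GE n => (1 - q1)^-1 * x i ^ n
  | GF n => - (1 - q1^-1)^-1 * x (i - 1) ^ n
  | GPsiP j => psip_eig q1 q2 q3 u i j
  | GPsiM j => psim_eig q1 q2 q3 u i j
  | GPsiP0V | GPsiM0V => 1
  end.

Definition Vu_gen (g : Egen) : {linear V -> V} :=
  malg_lift (fun i => Vu_coef g i *: ket (i + Vu_shift g)).

Local Notation rho := (freealg_act Vu_gen).

Lemma Vu_gen_ket g i : Vu_gen g (ket i) = Vu_coef g i *: ket (i + Vu_shift g).
Proof. exact: malg_liftU. Qed.

Lemma rho_gen_ket g i :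
  rho (freegen K g) (ket i) = Vu_coef g i *: ket (i + Vu_shift g).
Proof. by rewrite freealg_act_gen Vu_gen_ket. Qed.

Lemma ev_pt_neq0 i : x i != 0.
Proof. by rewrite mulf_neq0 ?expfz_neq0. Qed.

Lemma ev_ptS i : x (i + 1) = q1 * x i.
Proof. by rewrite /x expfzDr // expr1z [_ * q1]mulrC mulrA. Qed.

Lemma ev_ptP i : x (i - 1) = x i / q1.
Proof. by rewrite -[i in RHS](subrK 1) ev_ptS mulrAC divff // mul1r. Qed.

Lemma psip_eigE i j : psip_eig q1 q2 q3 u i j = psip (x i) j.
Proof.
have q23 : q2 * q3 = q1^-1.
  by apply: (mulfI q1_neq0); rewrite divff // mulrA.
rewrite /psip_eig (ratser_quadratics (A := psi_res q1 q2 q3)).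
- rewrite expfzDr // exprN1 (_ : q1 ^ i / q1 * u = x i / q1); last exact: mulrAC.
  by rewrite /psip_coef /psi_jump.
- rewrite expfzDr // exprN1 -[q1 ^ i / q1 * u]mulrA [q1^-1 * u]mulrC -q23 /x; ring.
- rewrite expfzDr // exprN1 /psi_res.
  have -> : (1 - q2) * (1 - q3) = 1 + q1^-1 - q2 - q3 by rewrite -q23; ring.
  by field; rewrite q1_neq0 subr_eq0 q1_neq1.
Qed.

(** The parameters of the expansion at z = 0 are the inverses of those at
    infinity, and passing from one to the other changes the sign of the
    residue. *)
Lemma psim_eigE i j : psim_eig q1 q2 q3 u i j = psim (x i) (- j%:Z).
Proof.
have q3E : q3 = (q1 * q2)^-1.
  by apply: (mulfI (mulf_neq0 q1_neq0 q2_neq0)); rewrite divff ?mulf_neq0.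
have q1B : q1 - 1 != 0 by rewrite subr_eq0.
have q1i : q1 ^ i != 0 by rewrite expfz_neq0.
have xV : q1 ^ (- i) / u = (x i)^-1 by rewrite -invr_expz -invfM.
have yV : q1 ^ (- i + 1) / u = (x i / q1)^-1.
  by rewrite expfzDr // expr1z invfM invrK -xV mulrAC.
rewrite /psim_eig xV yV (ratser_quadratics (A := - psi_res q1 q2 q3)).
- rewrite /psim_coef oppr_eq0 oppr_le0 /= /psi_jump mulNr.
  by rewrite -[x i ^ _]exprz_inv -[(_ / q1) ^ _]exprz_inv.
- by rewrite -invr_expz q3E /x; field; rewrite q1_neq0 q2_neq0 u_neq0 q1i oner_eq0.
- rewrite -invr_expz /psi_res q3E /x; field.
  by rewrite ?q1_neq0 ?q2_neq0 ?q1i ?u_neq0 ?q1B ?oner_eq0.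
Qed.

Lemma rho_e n i :
  rho (e_ser K n) (ket i) = ((1 - q1)^-1 * x i ^ n) *: ket (i + 1).
Proof. exact: rho_gen_ket. Qed.

Lemma rho_f n i :
  rho (f_ser K n) (ket i) = (- (1 - q1^-1)^-1 * x (i - 1) ^ n) *: ket (i - 1).
Proof. exact: rho_gen_ket. Qed.

Lemma rho_psip_ser m i : rho (psip_ser K m) (ket i) = psip (x i) m *: ket i.
Proof.
case: m => n; rewrite /psip_ser /=.
  by rewrite rho_gen_ket /= addr0 psip_eigE.
by rewrite freealg_act0 /psip_coef /= addr0 scale0r.
Qed.

Lemma rho_psim_ser m i : rho (psim_ser K m) (ket i) = psim (x i) m *: ket i.
Proof.
rewrite /psim_ser; case: ifP => m0.
  by rewrite rho_gen_ket /= addr0 psim_eigE; congr (psim _ _ *: _); lia.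
rewrite freealg_act0 /psim_coef m0 subr0; case: eqP m0 => [->//|_ _].
by rewrite scale0r.
Qed.

(** Coefficients are read in K^o, the algebra K over itself, so that the shift
    operators apply to scalar series as well. *)
Lemma rho_mul_lin (a b : K) (F : int -> int -> freealg K Egen)
    (G : int -> int -> K^o) v w :
  (forall m n, rho (F m n) v = G m n *: w) ->
  forall m n, rho (mul_lin a b F m n) v = mul_lin a b G m n *: w.
Proof.
move=> FG m n.
rewrite [LHS]freealg_actD.
rewrite [X in X + _ = _]freealg_actZ [X in _ + X = _]freealg_actZ !FG !scalerA.
by rewrite -[X in _ = X *: w]/(a * G (m + 1) n + b * G m (n + 1)) scalerDl.
Qed.

Lemma rho_gzw_sep (F : int -> int -> freealg K Egen) v w b c s :
  b != 0 -> (forall m n, rho (F m n) v = (c * s m * b ^ n) *: w) ->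
  forall m n, rho (mul_gzw q1 q2 q3 F m n) v
              = (c * gz_shift q1 q2 q3 b s m * b ^ n) *: w.
Proof.
move=> b0 FG m n; rewrite -mul_gzw_sep //.
by do 3!apply: rho_mul_lin => {}m {}n.
Qed.

Lemma rho_gwz_sep (F : int -> int -> freealg K Egen) v w b c s :
  b != 0 -> (forall m n, rho (F m n) v = (c * s m * b ^ n) *: w) ->
  forall m n, rho (mul_gwz q1 q2 q3 F m n) v
              = (c * gw_shift q1 q2 q3 b s m * b ^ n) *: w.
Proof.
move=> b0 FG m n; rewrite -mul_gwz_sep //.
by do 3!apply: rho_mul_lin => {}m {}n.
Qed.

(** This matches the normalization by g(1, 1) of the relation between e and f
    with the product of the normalizations of e and f. *)
Lemma psi_res_gpoly :
  (gpoly q1 q2 q3 1 1)^-1 * psi_res q1 q2 q3 = (1 - q1)^-1 * (1 - q1^-1)^-1.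
Proof.
rewrite /gpoly /psi_res !mulr1; field.
by rewrite q1_neq0 !subr_eq0 /= ![1 == _]eq_sym q1_neq1 q2_neq1 q3_neq1.
Qed.

Lemma rho_gzw_exp0 F v w b c a :
  a != 0 -> b != 0 -> gpoly q1 q2 q3 a b = 0 ->
  (forall m n, rho (F m n) v = (c * a ^ m * b ^ n) *: w) ->
  forall m n, rho (mul_gzw q1 q2 q3 F m n) v = 0.
Proof.
move=> a0 b0 g0 FE m n; rewrite (rho_gzw_sep (s := fun m => a ^ m) b0 FE).
by rewrite gz_shift_exp // g0 mul0r mulr0 mul0r scale0r.
Qed.

Lemma rho_gwz_exp0 F v w b c a :
  a != 0 -> b != 0 -> gpoly q1 q2 q3 b a = 0 ->
  (forall m n, rho (F m n) v = (c * a ^ m * b ^ n) *: w) ->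
  forall m n, rho (mul_gwz q1 q2 q3 F m n) v = 0.
Proof.
move=> a0 b0 g0 FE m n; rewrite (rho_gwz_sep (s := fun m => a ^ m) b0 FE).
by rewrite gw_shift_exp // g0 mul0r mulr0 mul0r scale0r.
Qed.

Lemma gpoly_ev_pt i : gpoly q1 q2 q3 (x (i + 1)) (x i) = 0.
Proof. by rewrite /gpoly ev_ptS subrr !mul0r. Qed.

Lemma rho_ee m n i :
  rho (mul_gzw q1 q2 q3 (ser_zw (e_ser K) (e_ser K)) m n) (ket i)
  = rho (- mul_gwz q1 q2 q3 (ser_wz (e_ser K) (e_ser K)) m n) (ket i).
Proof.
have rho2 (k l : int) : rho (e_ser K k * e_ser K l) (ket i)
    = ((1 - q1)^-1 ^+ 2 * x (i + 1) ^ k * x i ^ l) *: ket (i + 1 + 1).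
  by rewrite (freealg_actM_scale (rho_e l i) (rho_e k (i + 1))); congr (_ *: _); ring.
rewrite freealg_actN.
rewrite [LHS](rho_gzw_exp0 (ev_pt_neq0 (i + 1)) (ev_pt_neq0 i) (gpoly_ev_pt i) rho2).
rewrite [X in _ = - X](rho_gwz_exp0 (ev_pt_neq0 i) (ev_pt_neq0 (i + 1)) (gpoly_ev_pt i)
           (c := (1 - q1)^-1 ^+ 2) (w := ket (i + 1 + 1))) ?oppr0 //.
by move=> k l; rewrite /ser_wz rho2 mulrAC.
Qed.

Lemma rho_ff m n i :
  rho (mul_gwz q1 q2 q3 (ser_zw (f_ser K) (f_ser K)) m n) (ket i)
  = rho (- mul_gzw q1 q2 q3 (ser_wz (f_ser K) (f_ser K)) m n) (ket i).
Proof.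
have rho2 (k l : int) : rho (f_ser K k * f_ser K l) (ket i)
    = ((1 - q1^-1)^-1 ^+ 2 * x (i - 1 - 1) ^ k * x (i - 1) ^ l) *: ket (i - 1 - 1).
  by rewrite (freealg_actM_scale (rho_f l i) (rho_f k (i - 1))); congr (_ *: _); ring.
have g0 : gpoly q1 q2 q3 (x (i - 1)) (x (i - 1 - 1)) = 0.
  by have := gpoly_ev_pt (i - 1 - 1); rewrite subrK.
rewrite freealg_actN.
rewrite [LHS](rho_gwz_exp0 (ev_pt_neq0 (i - 1 - 1)) (ev_pt_neq0 (i - 1)) g0 rho2).
rewrite [X in _ = - X](rho_gzw_exp0 (ev_pt_neq0 (i - 1)) (ev_pt_neq0 (i - 1 - 1)) g0
           (c := (1 - q1^-1)^-1 ^+ 2) (w := ket (i - 1 - 1))) ?oppr0 //.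
by move=> k l; rewrite /ser_wz rho2 mulrAC.
Qed.

(** Both psi^+ and psi^- satisfy the intertwining identity at every point; this
    is all that their relations with e and f require.  Note that x_(i-1) is the
    base point for f, since f lowers i before psi is evaluated. *)
Section PsiRelations.
Variables (psi : int -> freealg K Egen) (s : K -> int -> K).
Hypothesis rho_psi : forall m i, rho (psi m) (ket i) = s (x i) m *: ket i.
Hypothesis s_intertwine : forall y m, y != 0 ->
  gz_shift q1 q2 q3 y (s (q1 * y)) m = - gw_shift q1 q2 q3 y (s y) m.

Lemma rho_psi_e m n i :
  rho (mul_gzw q1 q2 q3 (ser_zw psi (e_ser K)) m n) (ket i)
  = rho (- mul_gwz q1 q2 q3 (ser_wz (e_ser K) psi) m n) (ket i).
Proof.
rewrite freealg_actN.
rewrite [LHS](rho_gzw_sep (b := x i) (c := (1 - q1)^-1) (s := s (x (i + 1)))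
           (w := ket (i + 1)) (ev_pt_neq0 i)); last first.
  move=> k l; rewrite [LHS](freealg_actM_scale (rho_e l i) (rho_psi k (i + 1))).
  by congr (_ *: _); ring.
rewrite [X in _ = - X](rho_gwz_sep (b := x i) (c := (1 - q1)^-1) (s := s (x i))
           (w := ket (i + 1)) (ev_pt_neq0 i)); last first.
  move=> k l; rewrite [LHS](freealg_actM_scale (rho_psi k i) (rho_e l i)).
  by congr (_ *: _); ring.
by rewrite ev_ptS s_intertwine ?ev_pt_neq0 // -scaleNr; congr (_ *: _); ring.
Qed.

Lemma rho_psi_f m n i :
  rho (mul_gwz q1 q2 q3 (ser_zw psi (f_ser K)) m n) (ket i)
  = rho (- mul_gzw q1 q2 q3 (ser_wz (f_ser K) psi) m n) (ket i).
Proof.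
have xiE : x i = q1 * x (i - 1) by rewrite -ev_ptS subrK.
rewrite freealg_actN.
rewrite [LHS](rho_gwz_sep (b := x (i - 1)) (c := - (1 - q1^-1)^-1)
           (s := s (x (i - 1))) (w := ket (i - 1)) (ev_pt_neq0 (i - 1))); last first.
  move=> k l; rewrite [LHS](freealg_actM_scale (rho_f l i) (rho_psi k (i - 1))).
  by congr (_ *: _); ring.
rewrite [X in _ = - X](rho_gzw_sep (b := x (i - 1)) (c := - (1 - q1^-1)^-1) (s := s (x i))
           (w := ket (i - 1)) (ev_pt_neq0 (i - 1))); last first.
  move=> k l; rewrite [LHS](freealg_actM_scale (rho_psi k i) (rho_f l i)).
  by congr (_ *: _); ring.
by rewrite xiE s_intertwine ?ev_pt_neq0 // -scaleNr; congr (_ *: _); ring.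
Qed.

End PsiRelations.

Lemma rho_ef m n i :
  rho (commutator (e_ser K m) (f_ser K n)) (ket i)
  = rho ((gpoly q1 q2 q3 1 1)^-1 *:
           mul_delta (fun i => psip_ser K i - psim_ser K i) m n) (ket i).
Proof.
have e_f := rho_e m (i - 1); rewrite subrK in e_f.
have f_e := rho_f n (i + 1); rewrite addrK in f_e.
rewrite [LHS](freealg_act_commutator_scale (rho_f n i) e_f (rho_e m i) f_e).
rewrite [RHS]freealg_actZ [X in _ = _ *: X]freealg_actB rho_psip_ser rho_psim_ser.
rewrite -scalerBl psi_jumpE scalerA /psi_jump [in RHS]mulrA psi_res_gpoly -ev_ptP.
by congr (_ *: _); rewrite !expfzDr ?ev_pt_neq0 //; ring.
Qed.

Lemma rho_diag g i : Vu_shift g = 0 ->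
  rho (freegen K g) (ket i) = Vu_coef g i *: ket i.
Proof. by move=> g0; rewrite rho_gen_ket g0 addr0. Qed.

Lemma rho_diag_comm g g' i : Vu_shift g = 0 -> Vu_shift g' = 0 ->
  rho (commutator (freegen K g) (freegen K g')) (ket i) = rho 0 (ket i).
Proof.
move=> /rho_diag-/(_ i) gi /rho_diag-/(_ i) g'i.
rewrite [LHS](freealg_act_commutator_scale g'i gi gi g'i) mulrC subrr scale0r.
by rewrite freealg_act0.
Qed.

Lemma psip_coef0 y : psip y 0 = 1.
Proof. by rewrite /psip_coef /psi_jump !expr0z subrr mulr0 addr0. Qed.

Lemma psim_coef0 y : psim y 0 = 1.
Proof. by rewrite /psim_coef /psi_jump !expr0z subrr mulr0 subr0. Qed.

Lemma rho_inv g g' i :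
  Vu_shift g = 0 -> Vu_shift g' = 0 -> Vu_coef g i = 1 -> Vu_coef g' i = 1 ->
  rho (freegen K g * freegen K g') (ket i) = rho 1 (ket i).
Proof.
move=> /rho_diag-/(_ i) gi /rho_diag-/(_ i) g'i g1 g'1.
by rewrite (freealg_actM_scale g'i gi) g1 g'1 mulr1 scale1r freealg_act1.
Qed.

(** The weight of [e_1, e_-1] does not depend on the basis vector, nor does that
    of e_0, so these two operators commute. *)
Lemma rho_eee i :
  rho (commutator (e_ser K 0) (commutator (e_ser K 1) (e_ser K (-1)))) (ket i)
  = rho 0 (ket i).
Proof.
have comm2 j : rho (commutator (e_ser K 1) (e_ser K (-1))) (ket j)
    = ((1 - q1)^-1 ^+ 2 * (q1 - q1^-1)) *: ket (j + 1 + 1).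
  rewrite [LHS](freealg_act_commutator_scale (rho_e _ j) (rho_e _ (j + 1))
                  (rho_e _ j) (rho_e _ (j + 1))) ev_ptS.
  congr (_ *: _); rewrite !expr1z !exprN1.
  by field; rewrite ?q1_neq0 ?ev_pt_neq0 subr_eq0 eq_sym q1_neq1.
rewrite [LHS](freealg_act_commutator_scale (comm2 i) (rho_e _ _)
                (rho_e _ i) (comm2 _)).
by rewrite freealg_act0 !expr0z mulr1 mulrC subrr scale0r.
Qed.

Lemma rho_fff i :
  rho (commutator (f_ser K 0) (commutator (f_ser K 1) (f_ser K (-1)))) (ket i)
  = rho 0 (ket i).
Proof.
have comm2 j : rho (commutator (f_ser K 1) (f_ser K (-1))) (ket j)
    = ((1 - q1^-1)^-1 ^+ 2 * (q1^-1 - q1)) *: ket (j - 1 - 1).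
  rewrite [LHS](freealg_act_commutator_scale (rho_f _ j) (rho_f _ (j - 1))
                  (rho_f _ j) (rho_f _ (j - 1))) !ev_ptP.
  congr (_ *: _); rewrite !expr1z !exprN1.
  by field; rewrite ?q1_neq0 ?ev_pt_neq0 subr_eq0 q1_neq1.
rewrite [LHS](freealg_act_commutator_scale (comm2 i) (rho_f _ _)
                (rho_f _ i) (comm2 _)).
by rewrite freealg_act0 !expr0z mulr1 mulrC subrr scale0r.
Qed.

Lemma rho_rel_ket X Y i : Erel q1 q2 q3 X Y -> rho X (ket i) = rho Y (ket i).
Proof.
have p0 : Vu_coef (GPsiP 0) i = 1 by rewrite /= psip_eigE psip_coef0.
have m0 : Vu_coef (GPsiM 0) i = 1 by rewrite /= psim_eigE psim_coef0.
have pI y m := psip_intertwine q1_neq0 q1_neq1 q123 (x := y) m.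
have mI y m := psim_intertwine q1_neq0 q1_neq1 q123 (x := y) m.
case=> {X Y} [m n|m n|m n|m n|m n|m n|m n|j k|j k|j k|||||| ].
- exact: rho_ee.
- exact: rho_ff.
- exact: rho_psi_e rho_psip_ser pI _ _ _.
- exact: rho_psi_e rho_psim_ser mI _ _ _.
- exact: rho_psi_f rho_psip_ser pI _ _ _.
- exact: rho_psi_f rho_psim_ser mI _ _ _.
- exact: rho_ef.
- exact: rho_diag_comm.
- exact: rho_diag_comm.
- exact: rho_diag_comm.
- exact: rho_inv.
- exact: rho_inv.
- exact: rho_inv.
- exact: rho_inv.
- exact: rho_eee.
- exact: rho_fff.
Qed.

Lemma rho_rel X Y : Erel q1 q2 q3 X Y -> forall v, rho X v = rho Y v.
Proof.
move=> XY; apply: eq_malg_linear; try exact: freealg_act_linearr.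
by move=> i; exact: rho_rel_ket.
Qed.

Definition Vu_act : Ealg q1 q2 q3 -> V -> V :=
  presented_act (rel := Erel q1 q2 q3) Vu_gen.

Lemma Vu_act_gen g v : Vu_act (Eof q1 q2 q3 g) v = Vu_gen g v.
Proof. by rewrite [LHS](presented_act_pi rho_rel) freealg_act_gen. Qed.

Lemma is_EmoduleP (act : Ealg q1 q2 q3 -> V -> V) :
  is_Emodule act <-> module_axioms (rel := Erel q1 q2 q3) act.
Proof. by split; case; split. Qed.

Lemma Vu_act_module : is_Emodule Vu_act.
Proof. exact/is_EmoduleP/presented_act_module/rho_rel. Qed.

Lemma Vu_act_assignment : Vu_assignment Vu_act.
Proof.
split=> [n i|n i|j i|j i]; rewrite Vu_act_gen [Vu_gen _ _]Vu_gen_ket /=.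
- by rewrite scalerA mulrA divff ?mul1r // subr_eq0 eq_sym.
- rewrite scalerA mulrA mulNr mulrN opprK divff ?mul1r //.
  by rewrite subr_eq0 eq_sym invr_eq1.
- by rewrite addr0.
- by rewrite addr0.
Qed.

Lemma Vu_act_level : has_level Vu_act 1 1.
Proof.
have diag1 g v : Vu_shift g = 0 -> (forall i, Vu_coef g i = 1) ->
    Vu_act (Eof q1 q2 q3 g) v = v.
  move=> g0 g1; rewrite Vu_act_gen.
  apply: (eq_malg_linear (g := id)) => // [|i]; first exact: linearP.
  by rewrite [LHS]Vu_gen_ket g0 g1 addr0 scale1r.
by move=> v; rewrite !scale1r; split; apply: diag1 => //= i;
  rewrite ?psip_eigE ?psim_eigE ?psip_coef0 ?psim_coef0.
Qed.

Lemma Eof_psiV :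
  Eof q1 q2 q3 GPsiP0V * Eof q1 q2 q3 (GPsiP 0) = 1 /\
  Eof q1 q2 q3 GPsiM0V * Eof q1 q2 q3 (GPsiM 0) = 1.
Proof.
split; rewrite -[LHS]quotalg_piM; apply/quotalg_eqP/asboolP/rel_ideal_gen.
  exact: Erel_Vp.
exact: Erel_Vm.
Qed.

Lemma Vu_action_unique (act : Ealg q1 q2 q3 -> V -> V) :
  is_Emodule act -> Vu_assignment act -> forall a v, act a v = Vu_act a v.
Proof.
move=> mod [eP fP pP mP]; have /is_EmoduleP mod' := mod.
apply: (eq_module_action mod' (proj1 (is_EmoduleP _) Vu_act_module)) => g.
apply: eq_malg_linear => [|c v w|i].
- exact: mod_linearr mod' _.
- by rewrite !Vu_act_gen linearP.
rewrite -[quotalg_pi _ _]/(Eof q1 q2 q3 g) -/(ket i) Vu_act_gen Vu_gen_ket.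
have inv g0 g0V : Eof q1 q2 q3 g0V * Eof q1 q2 q3 g0 = 1 ->
    act (Eof q1 q2 q3 g0) (ket i) = ket i -> act (Eof q1 q2 q3 g0V) (ket i) = ket i.
  by move=> gg gi; rewrite -{1}gi -(mod_actM mod') gg (mod_act1 mod').
case: g => [n|n|j|j||] /=.
- apply: (scalerI (a := 1 - q1)); first by rewrite subr_eq0 eq_sym.
  by rewrite eP scalerA mulrA divff ?mul1r // subr_eq0 eq_sym.
- have q1VB : 1 - q1^-1 != 0 by rewrite subr_eq0 eq_sym invr_eq1.
  apply: (scalerI (a := - (1 - q1^-1))); first by rewrite oppr_eq0.
  by rewrite fP scalerA mulrA mulrNN divff ?mul1r.
- by rewrite pP addr0.
- by rewrite mP addr0.
- rewrite addr0 scale1r; apply: inv Eof_psiV.1 _.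
  by rewrite pP psip_eigE psip_coef0 scale1r.
- rewrite addr0 scale1r; apply: inv Eof_psiV.2 _.
  by rewrite mP psim_eigE psim_coef0 scale1r.
Qed.

End VectorRepresentation.

Theorem proposition3p1 (R : realType) (q1 q2 q3 u : R[i])
    (q1_neq0 : q1 != 0) (q2_neq0 : q2 != 0) (q3_neq0 : q3 != 0)
    (q1_neq1 : q1 != 1) (q2_neq1 : q2 != 1) (q3_neq1 : q3 != 1)
    (q123 : q1 * q2 * q3 = 1) (u_neq0 : u != 0) :
  exists act : Ealg q1 q2 q3 -> Vu u -> Vu u,
    [/\ is_Emodule act, Vu_assignment act, has_level act 1 1
      & forall act' : Ealg q1 q2 q3 -> Vu u -> Vu u,
          is_Emodule act' -> Vu_assignment act' ->
          forall a v, act' a v = act a v].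
Proof.
exists (@Vu_act _ q1 q2 q3 u); split.
- exact: Vu_act_module.
- exact: Vu_act_assignment.
- exact: Vu_act_level.
- by move=> act' mod' asg'; exact: Vu_action_unique.
Qed.
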